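(* Let $(W,S)$ be a Coxeter system with $S$ finite, let $J\subseteq S$, let $w\in{}^JW$, and let $s\in A_R^J(w)$. Assume that $\deg(s)\le 2$. Then $$\Bigl||A_R^J(w)|-|A_R^J(ws)|\Bigr|\le 1.$$ More precisely: (i) If $\operatorname{Adj}(s)=\emptyset$, then $A_R^J(ws)=A_R^J(w)\setminus\{s\}$. (ii) If $\operatorname{Adj}(s)=\{r\}$, then $$A_R^J(ws)=\begin{cases}A_R^J(w)\setminus\{s\}, & \text{if }\Delta_R^J(w,s)\setminus A_R^J(w)=\emptyset,\\ \bigl(A_R^J(w)\setminus\{s\}\bigr)\sqcup\{r\}, & \text{if }\Delta_R^J(w,s)\setminus A_R^J(w)=\{r\}.\end{cases}$$ (iii) If $\operatorname{Adj}(s)=\{r,t\}$ (with $r\neq t$), then $$A_R^J(ws)=\begin{cases}A_R^J(w)\setminus\{s\}, & \text{if }\Delta_R^J(w,s)\setminus A_R^J(w)=\emptyset,\\ \bigl(A_R^J(w)\setminus\{s\}\bigr)\sqcup\{r\}, & \text{if }\Delta_R^J(w,s)\setminus A_R^J(w)=\{r\},\\ \bigl(A_R^J(w)\setminus\{s\}\bigr)\sqcup\{t\}, & \text{if }\Delta_R^J(w,s)\setminus A_R^J(w)=\{t\},\\ \bigl(A_R^J(w)\setminus\{s\}\bigr)\sqcup\{r,t\}, & \text{if }\Delta_R^J(w,s)\setminus A_R^J(w)=\{r,t\}.\end{cases}$$ Here $\sqcup$ denotes disjoint union, and in (ii) and (iii) the listed cases are exhaustive.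
   Context: Let $(W,S)$ be a Coxeter system with length function $\ell$, and let $T=\{wsw^{-1}\mid w\in W,\ s\in S\}$ be its set of reflections. For $J\subseteq S$, ${}^JW=\{w\in W\mid \ell(rw)>\ell(w)\ \text{for all } r\in J\}$, the set of minimal length representatives of the cosets $W_Jw$, where $W_J=\langle J\rangle$. The right ascent set of $w$ is $A_R(w)=\{s\in S\mid \ell(ws)=\ell(w)+1\}$, and the right $J$-ascent set is $A_R^J(w)=\{s\in A_R(w)\mid ws\in{}^JW\}$. The right inversion set is $N_R(w)=\{t\in T\mid \ell(wt)<\ell(w)\}$. For $w\in W$ and $s\in S$, $\Delta_R^J(w,s):=\{r\in S\mid wsr\in{}^JW,\ \ell(srs)=3,\ srs\notin N_R(w)\}$. Here the condition $\ell(srs)=3$ is equivalent to $rs\neq sr$. For $s\in S$, $\operatorname{Adj}(s)=\{r\in S\mid rs\ne sr,\ r\neq s\}$ and $\deg(s)=|\operatorname{Adj}(s)|$. *)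

(* Defs.v *)
From mathcomp Require Import all_boot all_order all_algebra.
From mathcomp Require Import finmap.
From mathcomp Require Import boolp classical_sets.

Set Implicit Arguments.
Unset Strict Implicit.
Unset Printing Implicit Defensive.

Local Open Scope fset_scope.
Local Open Scope group_scope.

Section Coxeter.
Variable W : groupType.
Implicit Types (S J : {fset W}) (w s r t x : W).

Definition has_order x (n : nat) : Prop :=
  [/\ (0 < n)%N, x ^+ n = 1 & forall k : nat, (0 < k < n)%N -> x ^+ k != 1].

Definition word_prod S (u : seq S) : W := \prod_(a <- u) val a.

(* The congruence on the free monoid of words over S generated by the
   relations (ab)^m = 1, for all a, b in S whose product has finite order m in
   W (no relation is imposed when ab has infinite order).  When the elements
   of S are involutions, a = b gives m = 1 and the relation aa = 1, so every
   letter is its own inverse modulo the congruence and the quotient monoid is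
   the group presented by these relations. *)
Inductive coxeter_cong S : seq S -> seq S -> Prop :=
| coxeter_cong_refl u : coxeter_cong u u
| coxeter_cong_sym u v : coxeter_cong u v -> coxeter_cong v u
| coxeter_cong_trans u v z :
    coxeter_cong u v -> coxeter_cong v z -> coxeter_cong u z
| coxeter_cong_cat u u' v v' :
    coxeter_cong u u' -> coxeter_cong v v' -> coxeter_cong (u ++ v) (u' ++ v')
| coxeter_cong_rel (a b : S) m :
    has_order (val a * val b) m ->
    coxeter_cong (flatten (nseq m [:: a; b])) [::].

(* (W, S) is a Coxeter system, with Coxeter matrix m(a, b) = order of ab: S
   consists of elements of order 2, generates W, and W has the presentation
   < S | (ab)^m(a, b) = 1 whenever m(a, b) is finite >. *)
Definition coxeter_system S : Prop :=
  [/\ forall s, s \in S -> has_order s 2,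
      forall w, exists u : seq S, word_prod u = w
    & forall u v : seq S, word_prod u = word_prod v <-> coxeter_cong u v].

(* The default value 0 of xget is only taken when w is not a product of
   elements of S, which does not occur in a Coxeter system. *)
Definition length S w : nat :=
  xget 0%N [set n : nat | (exists2 u : seq S, word_prod u = w & size u = n) /\
                          (forall u : seq S, word_prod u = w -> n <= size u)%N].

Definition reflections S : set W :=
  [set t | exists w, exists2 s, s \in S & t = w * s * w^-1].

Definition minimal_reps S J : set W :=
  [set w | forall r, r \in J -> (length S w < length S (r * w))%N].

Definition right_ascents S w : {fset W} :=
  [fset s in S | length S (w * s) == (length S w).+1].

Definition right_J_ascents S J w : {fset W} :=
  [fset s in right_ascents S w | w * s \in minimal_reps S J].

Definition right_inversions S w : set W :=
  [set t | reflections S t /\ (length S (w * t) < length S w)%N].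

Definition Delta S J w s : {fset W} :=
  [fset r in S | [&& w * s * r \in minimal_reps S J,
                     length S (s * r * s) == 3
                   & s * r * s \notin right_inversions S w]].

Definition Adj S s : {fset W} := [fset r in S | (r * s != s * r) && (r != s)].

Definition deg S s : nat := #|` Adj S s|.

Definition is_disjoint_union (C A B : {fset W}) : Prop :=
  C = A `|` B /\ [disjoint A & B].

End Coxeter.

(* Main.v *)
Require Import Defs.
From mathcomp Require Import all_boot all_order all_algebra.
From mathcomp Require Import finmap.
From mathcomp Require Import boolp classical_sets.

Local Open Scope fset_scope.
Local Open Scope group_scope.

(** Write A, A' and D for the J-ascent sets of w and ws and for the part of
    Delta outside A.  The theorem comes down to A' being the disjoint union of
    A minus s and D, together with D being contained in Adj s
    ([J_ascents_step], [Delta_sub_Adj]): D is then a subset of a set with at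
    most two elements, and |A| - |A'| = 1 - |D|.

    The decomposition holds for three reasons.
    - An ascent r <> s in A stays in A' ([J_ascent_kept]).  As r and s are both
      ascents of w, w is shortest in its coset by the dihedral group generated
      by r and s, so the lengths of wsr and (when r and s do not commute) wsrs
      are forced.  If wsr left the set of minimal representatives, then
      wsr = jws for some j in J, that is jw = wsrs: when r and s commute this
      is wr, which is a minimal representative, a contradiction; otherwise
      wsrs is three letters longer than w, which jw cannot be.
    - A new ascent does not commute with s ([J_ascent_comm]): a commuting one
      can be moved past s, both in wsr and in an equation wr = jw.
    - Among the r not commuting with s, membership in A' and in Delta agree
      ([mem_Delta]): if wsr were shorter than ws, exchange would make wsrs
      shorter than w, so that srs would be an inversion of w.

    Everything rests on the exchange condition ([exchange]), which has to be
    extracted from the presentation of W.  To a word a_1 ... a_k and an element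
    t one attaches the parity of the number of indices i with
    t = (a_(i+1) ... a_k)^-1 a_i (a_(i+1) ... a_k).  The defining relations do
    not change it ([inv_parity_cong]), so it depends only on the element of W
    that the word represents, and it is odd when t is a generator and a right
    descent ([descent_inv_parity]).  An index i counted by it is a letter whose
    deletion multiplies the product by t on the right
    ([inv_parity_delete]). *)

(** * Words and the parity of inversions *)

Section CoxeterTheory.

Set Implicit Arguments.
Unset Strict Implicit.

Variables (W : groupType) (S : {fset W}).
Implicit Types (a b : S) (u v : seq S) (s t r w x : W).

Lemma word_prod_nil : word_prod (@nil S) = 1.
Proof. by rewrite /word_prod big_nil. Qed.

Lemma word_prod_cons a u : word_prod (a :: u) = val a * word_prod u.
Proof. by rewrite /word_prod big_cons. Qed.

Lemma word_prod_cat u v : word_prod (u ++ v) = word_prod u * word_prod v.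
Proof. by rewrite /word_prod big_cat. Qed.

Lemma word_prod_rcons u a : word_prod (rcons u a) = word_prod u * val a.
Proof. by rewrite -cats1 word_prod_cat word_prod_cons word_prod_nil mulg1. Qed.

Lemma word_prod_nseq a b k :
  word_prod (flatten (nseq k [:: a; b])) = (val a * val b) ^+ k.
Proof.
elim: k => [|k IHk]; first by rewrite word_prod_nil.
by rewrite /= !word_prod_cons IHk mulgA expgS.
Qed.

(** This is a reflection cocycle: it will turn out to depend on the product of
    the word only, and its value at a reflection t tells whether t is a right
    inversion of that product.  It makes sense for every t of W, which avoids
    any bookkeeping about reflections. *)
Fixpoint inv_parity u t : bool :=
  if u is a :: u' then (t == val a ^ word_prod u') (+) inv_parity u' t
  else false.

Lemma inv_parity_cons a u t :
  inv_parity (a :: u) t = (t == val a ^ word_prod u) (+) inv_parity u t.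
Proof. by []. Qed.

Lemma inv_parity_cat u v t :
  inv_parity (u ++ v) t =
  inv_parity u (t ^ (word_prod v)^-1) (+) inv_parity v t.
Proof.
elim: u => [//|a u IHu] /=.
rewrite IHu word_prod_cat conjgM addbA.
by rewrite -[in RHS](inj_eq (@conjg_inj _ (word_prod v))) conjgKV.
Qed.

Hypothesis cox : coxeter_system S.

Lemma sq_gen s : s \in S -> s * s = 1.
Proof. by case: cox => + _ _ => ord /ord[_]. Qed.

Lemma gen_neq1 s : s \in S -> s != 1.
Proof. by case: cox => + _ _ => ord /ord[_ _ /(_ 1%N)]; apply. Qed.

Lemma gen_inv s : s \in S -> s^-1 = s.
Proof. by move=> /sq_gen /mulg1_eq. Qed.

Lemma genK s x : s \in S -> x * s * s = x.
Proof. by move=> sS; rewrite -mulgA sq_gen // mulg1. Qed.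

(** With p = ab, the conjugates read off the word (ab)^k are the elements
    b p^j for 0 <= j < 2k, each once: b conjugates p to its inverse, so a power
    of p can be moved across b. *)
Lemma inv_parity_nseq a b k t :
  inv_parity (flatten (nseq k [:: a; b])) t
  = odd (count (fun j => t == val b * (val a * val b) ^+ j) (iota 0 k.*2)).
Proof.
have aa := sq_gen (valP a); have bb := sq_gen (valP b).
set p := val a * val b.
have pbp : p * val b * p = val b.
  by rewrite /p -!mulgA (mulgA (val b)) bb mul1g mulgA aa mul1g.
have pkbpk i : p ^+ i * val b * p ^+ i = val b.
  elim: i => [|i IHi]; first by rewrite mul1g mulg1.
  by rewrite {1}expgSr expgS -[RHS]IHi -[in RHS]pbp !mulgA.
have bJ i : (p ^+ i)^-1 * val b = val b * p ^+ i.
  by apply: (mulgI (p ^+ i)); rewrite mulVKg mulgA pkbpk.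
elim: k => [//|k IHk].
rewrite doubleS -addn2 iotaD count_cat oddD -IHk add0n [count _ [:: _; _]]/=.
rewrite addn0 oddD !oddb.
rewrite -[flatten _]/[:: a, b & flatten (nseq k [:: a; b])] !inv_parity_cons.
rewrite word_prod_cons word_prod_nseq -/p addbA addbC; congr (_ (+) _).
rewrite addbC; congr (_ (+) _); congr (t == _).
  by rewrite conjgE mulgA bJ -mulgA -expgnDr addnn.
rewrite conjgM [_ ^ val b]conjgE conjgE (gen_inv (valP b)) mulgA mulgA bJ.
by rewrite -mulgA -/p -addnn -addnS expgnDr expgS !mulgA.
Qed.

(** Two full periods contribute an even count; this is what makes a relation
    (ab)^m = 1 invisible to the parity. *)
Lemma count_periodic (P : pred nat) m :
  (forall j, P (m + j)%N = P j) ->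
  count P (iota 0 m.*2) = (count P (iota 0 m)).*2.
Proof.
move=> per; rewrite -!addnn iotaD count_cat add0n; congr addn.
rewrite -[m in iota m _]addn0 iotaDl count_map.
by apply: eq_count => j /=; rewrite per.
Qed.

(** The presentation is used here only: two words with the same product are
    linked by the relations, and each relation has even parity everywhere. *)
Lemma inv_parity_cong u v :
  word_prod u = word_prod v -> forall t, inv_parity u t = inv_parity v t.
Proof.
case: cox => _ _ pres /[dup] uv /pres; move: uv => _.
elim=> {u v} [//|u v _ IH t|u v z _ IHuv _ IHvz t|u u' v v' uu' IHu vv' IHv t|a b m].
- by rewrite IH.
- by rewrite IHuv IHvz.
- by rewrite !inv_parity_cat IHu IHv; case: (pres v v') => _ /(_ vv') ->.
case=> _ abm _ t; rewrite inv_parity_nseq count_periodic ?odd_double //.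
by move=> j; rewrite expgnDr abm mul1g.
Qed.

(** * Length and the exchange condition *)

Lemma length_spec w :
  (exists2 u : seq S, word_prod u = w & size u = length S w) /\
  (forall u : seq S, word_prod u = w -> length S w <= size u)%N.
Proof.
have ex : exists n, `[< exists2 u : seq S, word_prod u = w & size u = n >].
  by case: cox => _ /(_ w)[u uw] _; exists (size u); apply/asboolP; exists u.
case: (ex_minnP ex) => n /asboolP wn nmin.
rewrite /length; case: xgetP => [m _ //|/(_ n)[]]; split=> // u uw.
by apply: nmin; apply/asboolP; exists u.
Qed.

Lemma exists_reduced w :
  exists2 u : seq S, word_prod u = w & size u = length S w.
Proof. by case: (length_spec w). Qed.

Lemma length_word_le u : (length S (word_prod u) <= size u)%N.
Proof. by case: (length_spec (word_prod u)) => _; apply. Qed.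

(** If t = v^-1 a v, where a is a letter of the word and v what follows it, then
    a v t = a a v = v, so multiplying by t erases that letter. *)
Lemma inv_parity_delete u t : inv_parity u t ->
  exists u1 a u2, u = u1 ++ a :: u2 /\ word_prod u * t = word_prod (u1 ++ u2).
Proof.
elim: u => [//|a u IHu]; rewrite inv_parity_cons.
case: eqVneq => [-> _|_ /IHu[u1 [b [u2 [-> ut]]]]]; last first.
  by exists (a :: u1), b, u2; split=> //; rewrite /= !word_prod_cons -mulgA ut.
exists [::], a, u; split=> //.
by rewrite word_prod_cons conjgE !mulgA mulgK (sq_gen (valP a)) mul1g.
Qed.

(** The parities of w and ws at s differ by the contribution of the last letter
    s.  Were the parity even at w, it would be odd at ws, and deleting a letter
    from a reduced word of ws would make w shorter than ws. *)
Lemma descent_inv_parity u s : s \in S ->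
  (length S (word_prod u * s) <= length S (word_prod u))%N -> inv_parity u s.
Proof.
move=> sS le_us; case us: (inv_parity u s) => //.
have [v vE sz_v] := exists_reduced (word_prod u * s).
have vs : inv_parity v s.
  pose a : S := [` sS].
  have -> : inv_parity v s = inv_parity (u ++ [:: a]) s.
    by apply: inv_parity_cong; rewrite vE cats1 word_prod_rcons.
  rewrite inv_parity_cat !inv_parity_cons word_prod_cons !word_prod_nil.
  rewrite mulg1 conjg1 eqxx.
  by rewrite conjgE invgK mulgV mulg1 us.
have [v1 [b [v2 [vv]]]] := inv_parity_delete vs.
rewrite vE genK // => uE.
have := length_word_le (v1 ++ v2); rewrite -uE => /(leq_trans le_us).
by rewrite -sz_v vv !size_cat addnS ltnn.
Qed.

(** The deleted letter lies either in a reduced word of x or in v.  In the first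
    case the shortened word of x represents x (v s v^-1); its length is all that
    is kept of it.  Keeping x as a group element lets the same statement
    serve cosets, where x is a shortest representative. *)
Lemma exchange x v s : s \in S ->
    (length S (x * word_prod v * s) <= length S (x * word_prod v))%N ->
  (length S (x * (word_prod v * s * (word_prod v)^-1)) < length S x)%N \/
  exists v1 a v2, v = v1 ++ a :: v2 /\ word_prod v * s = word_prod (v1 ++ v2).
Proof.
move=> sS; have [u <- <-] := exists_reduced x.
rewrite -word_prod_cat => /(descent_inv_parity sS).
rewrite inv_parity_cat; case vs: (inv_parity v s).
  by move=> _; right; apply: inv_parity_delete.
rewrite addbF conjgE invgK => /inv_parity_delete[u1 [a [u2 [-> uE]]]]; left.
rewrite -(mulgA (word_prod v)) uE; apply: leq_ltn_trans (length_word_le _) _.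
by rewrite !size_cat addnS.
Qed.

Lemma length_mulr_le w s : s \in S -> (length S (w * s) <= (length S w).+1)%N.
Proof.
move=> sS; have [u <- <-] := exists_reduced w.
by rewrite -(word_prod_rcons u [` sS]) -(size_rcons u [` sS]) length_word_le.
Qed.

Lemma length_mull_le w s : s \in S -> (length S (s * w) <= (length S w).+1)%N.
Proof.
move=> sS; have [u <- <-] := exists_reduced w.
rewrite -(word_prod_cons [` sS] u) -[(size u).+1]/(size ([` sS] :: u)).
exact: length_word_le.
Qed.

Lemma length1 : length S 1 = 0%N.
Proof. by apply/eqP; rewrite -leqn0 -word_prod_nil length_word_le. Qed.

Lemma length_eq0 w : length S w = 0%N -> w = 1.
Proof.
by have [u <- <-] := exists_reduced w; case: u => // _; exact: word_prod_nil.
Qed.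

Lemma length_gen s : s \in S -> length S s = 1%N.
Proof.
move=> sS; apply/eqP; rewrite eqn_leq -{1}[s]mul1g -{1}length1 length_mulr_le //.
by rewrite lt0n; apply: contra_neqN (gen_neq1 sS) => /eqP /length_eq0.
Qed.

Lemma length_mulr w s : s \in S ->
  length S (w * s) = (length S w).+1 \/ length S w = (length S (w * s)).+1.
Proof.
move=> sS; case: (ltnP (length S w) (length S (w * s))) => [lt_w|le_w].
  by left; apply/eqP; rewrite eqn_leq length_mulr_le.
right; apply/eqP; rewrite eqn_leq -{1}[w](genK w sS) length_mulr_le //.
have := @exchange w [::] s sS; rewrite word_prod_nil mulg1 mul1g invg1 mulg1.
by move=> /(_ le_w)[//|[[|? ?] [a [v2 []]]]].
Qed.

Lemma ascentE w s : s \in S ->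
  (length S (w * s) == (length S w).+1) = (length S w < length S (w * s))%N.
Proof.
move=> sS; case: (length_mulr w sS) => ->; first by rewrite eqxx ltnSn.
by rewrite ltnNge leqnSn; apply/negbTE; rewrite neq_ltn ltnS leqnSn.
Qed.

Lemma word_prod_rev u : word_prod (rev u) = (word_prod u)^-1.
Proof.
elim: u => [|a u IHu]; first by rewrite word_prod_nil invg1.
by rewrite rev_cons word_prod_rcons IHu word_prod_cons invgM (gen_inv (valP a)).
Qed.

(** * Cosets of parabolic and dihedral subgroups *)

(** Let x be shortest in the coset of w and let w = x v with v a word over I as
    short as possible.  By exchange the last letter of v is a descent of w,
    since a deletion could neither shorten x nor v.  As w has no descent in I,
    v is empty and w = x. *)
Lemma parabolic_min (I : {pred S}) w :
    (forall a, a \in I -> (length S w < length S (w * val a))%N) ->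
  forall v, all [in I] v -> (length S w <= length S (w * word_prod v))%N.
Proof.
move=> ascI.
have exm : exists n,
    `[< exists2 v, all [in I] v & length S (w * word_prod v) = n >].
  by exists (length S (w * word_prod (@nil S))); apply/asboolP; exists [::].
case: (ex_minnP exm) => n /asboolP[v0 Iv0 v0n] nmin.
pose x := w * word_prod v0.
have xmin v : all [in I] v -> (length S x <= length S (x * word_prod v))%N.
  move=> Iv; rewrite v0n; apply: nmin; apply/asboolP; exists (v0 ++ v).
    by rewrite all_cat Iv0.
  by rewrite word_prod_cat mulgA.
have exk : exists k,
    `[< exists v : seq S, [/\ all [in I] v, x * word_prod v = w & size v = k] >].
  exists (size (rev v0)); apply/asboolP; exists (rev v0).
  by rewrite all_rev word_prod_rev mulgK.
case: (ex_minnP exk) => k /asboolP[v [Iv vw vk]] kmin.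
suff v_nil : v = [::] by rewrite -vw v_nil word_prod_nil mulg1.
case/lastP: v => [//|v a] in Iv vw vk *.
move: Iv; rewrite all_rcons => /andP[Ia Iv]; rewrite word_prod_rcons mulgA in vw.
(* w is x v a: the ascent hypothesis at a says that appending a to x v does
   not increase the length, so exchange applies. *)
have := ascI a Ia; rewrite -{2}vw (genK _ (valP a)) -{1}vw => /ltnW.
case/(exchange (valP a)) => [|[v1 [b [v2 [vE vaE]]]]].
  (* v a v^-1 is the product of a word over I, so x would not be shortest. *)
  rewrite -word_prod_rcons -word_prod_rev -word_prod_cat ltnNge xmin //.
  by rewrite all_cat all_rcons all_rev Ia Iv.
have/kmin: `[< exists v : seq S,
    [/\ all [in I] v, x * word_prod v = w & size v = size (v1 ++ v2)] >].
  apply/asboolP; exists (v1 ++ v2); rewrite -vaE mulgA; split=> //.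
  by move: Iv; rewrite vE !all_cat => /and3P[Iv1 _ Iv2]; apply/andP.
by rewrite -vk size_rcons vE !size_cat addnS ltnNge ltnW.
Qed.

(** Two distinct ascents s and r of w generate a dihedral group; [parabolic_min]
    makes w the shortest element of its coset, so that a failure of length
    additivity has to come from a deletion among the letters s and r alone. *)
Section Dihedral.

Variables (w s r : W).
Hypotheses (sS : s \in S) (rS : r \in S) (neq_sr : s != r).
Hypotheses (asc_s : (length S w < length S (w * s))%N)
           (asc_r : (length S w < length S (w * r))%N).

Let a : S := [` sS].
Let b : S := [` rS].

Lemma dihedral_min v : all [in [:: a; b]] v ->
  (length S w <= length S (w * word_prod v))%N.
Proof. by apply: parabolic_min => c; rewrite !inE => /orP[] /eqP->. Qed.

Lemma dihedral_asc2 : (length S (w * s) < length S (w * s * r))%N.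
Proof.
rewrite ltnNge; apply/negP => le2.
have aE : word_prod [:: a] = s by rewrite word_prod_cons word_prod_nil mulg1.
have := @exchange w [:: a] r rS; rewrite aE => /(_ le2)[].
  (* The shorter element wsrs stays in the coset of w. *)
  rewrite (gen_inv sS) ltnNge; apply/negP/negPn.
  have := @dihedral_min [:: a; b; a].
  rewrite !word_prod_cons word_prod_nil mulg1 !mulgA; apply.
  by rewrite /= !inE !eqxx ?orbT.
case=> -[|? [|? ?]] [c [v2 [//= [_ <-]]]]; rewrite word_prod_nil => sr1.
by case/eqP: neq_sr; rewrite -(genK s rS) sr1 mul1g.
Qed.

Lemma dihedral_asc3 : s * r != r * s ->
  (length S (w * s * r) < length S (w * s * r * s))%N.
Proof.
move=> ncomm; rewrite ltnNge; apply/negP => le3.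
have abE : word_prod [:: a; b] = s * r.
  by rewrite !word_prod_cons word_prod_nil mulg1.
have := @exchange w [:: a; b] s sS; rewrite abE mulgA => /(_ le3)[].
  rewrite invgM (gen_inv sS) (gen_inv rS) ltnNge; apply/negP/negPn.
  have := @dihedral_min [:: a; b; a; b; a].
  rewrite !word_prod_cons word_prod_nil mulg1 !mulgA; apply.
  by rewrite /= !inE !eqxx ?orbT.
case=> -[|c1 [|c2 [|c3 v1]]] [c [v2 [//=]]].
- case=> _ <-; rewrite word_prod_cons word_prod_nil mulg1 /= => srs.
  by case/eqP: ncomm; rewrite -{2}srs genK.
- case=> <- _ <-; rewrite word_prod_cons word_prod_nil mulg1 /= => srs.
  have /mulgI rs1 : s * (r * s) = s * 1 by rewrite mulg1 mulgA.
  by case/eqP: neq_sr; rewrite -(genK r sS) rs1 mul1g.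
Qed.

End Dihedral.

Lemma length3_noncomm s r : s \in S -> r \in S ->
  (length S (s * r * s) == 3) = (r * s != s * r) && (r != s).
Proof.
move=> sS rS; case: (eqVneq r s) => [->|neq_rs].
  by rewrite sq_gen // mul1g length_gen // andbF.
rewrite andbT; have [rs|ncomm] := eqVneq (r * s) (s * r).
  by rewrite -rs genK // length_gen.
have asc t : t \in S -> (length S 1 < length S (1 * t))%N.
  by move=> tS; rewrite mul1g length1 length_gen.
have neq_sr : s != r by rewrite eq_sym.
have ncomm' : s * r != r * s by rewrite eq_sym.
have /= := dihedral_asc3 sS rS neq_sr (asc s sS) (asc r rS) ncomm'.
have := dihedral_asc2 sS rS neq_sr (asc s sS) (asc r rS).
rewrite -!(ascentE _) // => /eqP E2 /eqP.
by rewrite E2 !mul1g (length_gen sS) => ->.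
Qed.

Section Quotient.

Variable J : {fset W}.
Hypothesis JS : J `<=` S.

Lemma minimal_repsP w :
  reflect (forall j, j \in J -> (length S w < length S (j * w))%N)
          (w \in minimal_reps S J).
Proof. by apply: (iffP idP) => [/set_mem //|wJ]; apply: mem_set. Qed.

Lemma minimal_rep_lmul w j : j \in J -> j * w \in minimal_reps S J ->
  (length S (j * w) < length S w)%N.
Proof.
move=> jJ /minimal_repsP/(_ j jJ).
by rewrite mulgA sq_gen ?mul1g // (fsubsetP JS).
Qed.

(** * Ascents that stay among minimal coset representatives *)

(** Deodhar's lemma for an ascent.  Some j in J does not lengthen ws, while it
    lengthens w, so s is not an ascent of jw.  Exchange applied to the product
    of j and a reduced word of w must delete j, giving jws = w: a deletion
    inside w would contradict w < ws. *)
Lemma minimal_rep_ascent w s : s \in S -> w \in minimal_reps S J ->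
    (length S w < length S (w * s))%N -> w * s \notin minimal_reps S J ->
  exists2 j, j \in J & w * s = j * w.
Proof.
move=> sS /minimal_repsP wJ asc nJ.
have [j jJ le_j] : exists2 j, j \in J &
    (length S (j * (w * s)) <= length S (w * s))%N.
  apply: contrapT => nex; case/negP: nJ; apply/minimal_repsP => j jJ.
  by rewrite ltnNge; apply/negP => le_j; apply: nex; exists j.
exists j => //; have jS := fsubsetP JS j jJ.
have [u uw sz_u] := exists_reduced w.
have := @exchange j u s sS; rewrite uw -mulgA.
case/(_ (leq_trans le_j (leq_trans (length_mulr_le w sS) (wJ j jJ)))).
  (* Exchange says that j (w s w^-1) is shorter than j, hence trivial. *)
  rewrite (length_gen jS) ltnS leqn0 => /eqP/length_eq0 jx1.
  rewrite -[w * s]mul1g -(sq_gen jS) -mulgA; congr (j * _).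
  by apply: (mulIg w^-1); rewrite mulgV -mulgA.
case=> v1 [c [v2 [uE wsE]]]; have := length_word_le (v1 ++ v2).
rewrite -wsE => /(leq_trans asc); rewrite -sz_u uE !size_cat addnS.
by rewrite ltnNge leqnSn.
Qed.

Lemma mem_right_J_ascents w r :
  (r \in right_J_ascents S J w) =
  [&& r \in S, (length S w < length S (w * r))%N & w * r \in minimal_reps S J].
Proof.
by rewrite !inE /=; case rS: (r \in S) => //=; rewrite ascentE.
Qed.

Variables (w s : W).
Hypotheses (wJ : w \in minimal_reps S J) (sA : s \in right_J_ascents S J w).

Let sS : s \in S.
Proof. by move: sA; rewrite mem_right_J_ascents => /and3P[]. Qed.
Let ws_asc : (length S w < length S (w * s))%N.
Proof. by move: sA; rewrite mem_right_J_ascents => /and3P[]. Qed.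
Let wsJ : w * s \in minimal_reps S J.
Proof. by move: sA; rewrite mem_right_J_ascents => /and3P[]. Qed.

Lemma J_ascent_neq r : r \in right_J_ascents S J (w * s) -> r != s.
Proof.
rewrite mem_right_J_ascents => /and3P[_ asc _]; apply: contraTneq asc => ->.
by rewrite genK // -leqNgt ltnW.
Qed.

(** If wsr is not a minimal representative then jw = wsrs for some j in J,
    which contradicts minimality of wr when r and s commute, and
    l(wsrs) = l(w) + 3 when they do not. *)
Lemma J_ascent_kept r :
  r \in right_J_ascents S J w -> r != s -> r \in right_J_ascents S J (w * s).
Proof.
rewrite !mem_right_J_ascents => /and3P[rS wr_asc wrJ]; rewrite eq_sym => neq_sr.
have asc2 := dihedral_asc2 sS rS neq_sr ws_asc wr_asc.
rewrite rS asc2 /=; apply: contraT => wsrJ.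
have [j jJ wsrE] := minimal_rep_ascent rS wsJ asc2 wsrJ.
have jwE : j * w = w * s * r * s by rewrite wsrE -mulgA genK.
have [rs|ncomm] := eqVneq (s * r) (r * s).
  have jwr : j * w = w * r by rewrite jwE -(mulgA w) rs mulgA genK.
  have := @minimal_rep_lmul w j jJ; rewrite jwr => /(_ wrJ).
  by rewrite ltnNge ltnW.
have asc3 := dihedral_asc3 sS rS neq_sr ws_asc wr_asc ncomm.
have := length_mull_le w (fsubsetP JS j jJ); rewrite jwE.
by move=> /leq_ltn_trans/(_ (leq_ltn_trans ws_asc asc2)); rewrite ltnNge ltnW.
Qed.

(** Moving r to the left of s gives wsr = wrs, so r is an ascent of w, and an
    equation wr = jw would give wsr = jws, against the minimality of wsr because
    j takes it back to the shorter ws. *)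
Lemma J_ascent_comm r : r * s = s * r ->
  r \in right_J_ascents S J (w * s) -> r \in right_J_ascents S J w.
Proof.
move=> rs; rewrite !mem_right_J_ascents => /and3P[rS wsr_asc wsrJ].
have wrsE : w * s * r = w * r * s by rewrite -!mulgA rs.
have wr_asc : (length S w < length S (w * r))%N.
  rewrite -ltnS; apply: leq_trans (length_mulr_le (w * r) sS).
  by rewrite -wrsE; apply: leq_ltn_trans wsr_asc.
rewrite rS wr_asc /=; apply: contraT => nwrJ.
have [j jJ wrE] := minimal_rep_ascent rS wJ wr_asc nwrJ.
have := @minimal_rep_lmul (w * s) j jJ.
rewrite mulgA -wrE -wrsE => /(_ wsrJ).
by rewrite ltnNge ltnW.
Qed.

(** The condition l(srs) = 3 says that r is adjacent to s, and wsr being a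
    minimal representative is common to both sides.  What is left is that
    wsrs is not shorter than w exactly when wsr is longer than ws. *)
Lemma mem_Delta r :
  (r \in Delta S J w s) = (r \in Adj S s) && (r \in right_J_ascents S J (w * s)).
Proof.
rewrite mem_right_J_ascents !inE /=; case rS: (r \in S) => //=.
rewrite length3_noncomm // andbCA; apply: andb_id2l => /andP[ncomm neq_rs].
rewrite andbC; apply: andb_id2r => _.
apply/idP/idP => [ninv|asc2].
- rewrite ltnNge; apply/negP => le2; case/negP: ninv; apply/mem_set; split.
    by exists s, r; rewrite // gen_inv.
  have := @exchange w [:: [` sS]] r rS.
  rewrite word_prod_cons word_prod_nil mulg1 => /(_ le2)[].
    by rewrite (gen_inv sS).
  case=> -[|? [|? ?]] [c [v2 [//= [_ <-]]]]; rewrite word_prod_nil => sr1.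
  by case/eqP: neq_rs; rewrite -(genK s rS) sr1 mul1g.
- apply/negP => /set_mem[_]; rewrite !mulgA ltnNge; apply/negP/negPn.
  apply: leq_trans (ltnW ws_asc) _; rewrite -ltnS; apply: leq_trans asc2 _.
  by rewrite -{1}[w * s * r](genK _ sS) length_mulr_le.
Qed.

(** The new ascents are those of A' outside A; they are adjacent to s by
    [J_ascent_comm], hence exactly the elements of Delta outside A. *)
Lemma J_ascents_step :
  is_disjoint_union (right_J_ascents S J (w * s)) (right_J_ascents S J w `\ s)
    (Delta S J w s `\` right_J_ascents S J w).
Proof.
split; last by apply/fdisjointP => r; rewrite !in_fsetD => /andP[_ ->].
apply/fsetP => r; rewrite in_fsetU !in_fsetD in_fset1 mem_Delta.
apply/idP/idP => [rA'|/orP[/andP[neq_rs rA]|/and3P[]//]]; last first.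
  exact: J_ascent_kept.
have neq_rs := J_ascent_neq rA'.
have [//|nrA] := boolP (r \in right_J_ascents S J w).
  by rewrite neq_rs.
rewrite rA' andbT andbF /= !inE /= neq_rs andbT.
have -> /= : r \in S by move: rA'; rewrite mem_right_J_ascents => /and3P[].
by apply: contraNneq nrA => rs; apply: J_ascent_comm.
Qed.

Lemma Delta_sub_Adj : Delta S J w s `\` right_J_ascents S J w `<=` Adj S s.
Proof. by apply/fsubsetP => r; rewrite in_fsetD mem_Delta => /and3P[]. Qed.

End Quotient.
End CoxeterTheory.

(** * At most two adjacent generators *)

Lemma fsubset2 (K : choiceType) (D : {fset K}) (r t : K) : D `<=` [fset r; t] ->
  [\/ D = fset0, D = [fset r], D = [fset t] | D = [fset r; t]].
Proof.
rewrite -fsubDset fsubset1; have [rD|rD] := boolP (r \in D); last first.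
  by rewrite mem_fsetD1 // => /orP[] /eqP; [constructor 3|constructor 1].
have := fsetD1K rD => DE /orP[] /eqP Dr; rewrite Dr in DE; rewrite -DE.
  by constructor 4.
by constructor 2; rewrite fsetU0.
Qed.

Theorem corollary3p7 (W : groupType) (S : {fset W}) (hS : coxeter_system S)
    (J : {fset W}) (hJ : J `<=` S)
    (w : W) (hw : w \in minimal_reps S J)
    (s : W) (hs : s \in right_J_ascents S J w)
    (hdeg : (deg S s <= 2)%N) :
  let A := right_J_ascents S J w in
  let A' := right_J_ascents S J (w * s) in
  let D := Delta S J w s `\` A in
  [/\ (`| (#|` A|)%:Z - (#|` A'|)%:Z | <= 1)%R,
      Adj S s = fset0 -> A' = A `\ s,
      forall r : W, Adj S s = [fset r] ->
        [/\ D = fset0 \/ D = [fset r],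
            D = fset0 -> A' = A `\ s
          & D = [fset r] -> is_disjoint_union A' (A `\ s) [fset r]]
    & forall r t : W, r != t -> Adj S s = [fset r; t] ->
        [/\ [\/ D = fset0, D = [fset r], D = [fset t] | D = [fset r; t]],
            D = fset0 -> A' = A `\ s,
            D = [fset r] -> is_disjoint_union A' (A `\ s) [fset r],
            D = [fset t] -> is_disjoint_union A' (A `\ s) [fset t]
          & D = [fset r; t] -> is_disjoint_union A' (A `\ s) [fset r; t]]].
Proof.
move=> A A' D.
have step : is_disjoint_union A' (A `\ s) D := J_ascents_step hS hJ hw hs.
have DAdj : D `<=` Adj S s := Delta_sub_Adj hS hs.
have D0 : D = fset0 -> A' = A `\ s by case: step => -> _ ->; rewrite fsetU0.
have Deq X : D = X -> is_disjoint_union A' (A `\ s) X by move=> <-.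
split.
- case: step => -> /eqP dis.
  have := leq_trans (fsubset_leq_card DAdj) hdeg.
  rewrite cardfsU dis cardfs0 subn0 (cardfsD1 s A) hs addnC !PoszD.
  rewrite GRing.opprD GRing.addrACA GRing.subrr GRing.add0r.
  by case: #|` D| => [|[|[|]]].
- by move=> Adj0; apply: D0; apply/eqP; rewrite -fsubset0 -Adj0.
- move=> r Adj1; split=> //; last exact: Deq.
  by move: DAdj; rewrite Adj1 fsubset1 => /orP[] /eqP; [right|left].
- move=> r t _ Adj2; split=> //; try exact: Deq.
  by apply: fsubset2; rewrite -Adj2.
Qed.
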